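(* Let $\beta: I\to M\subset G^3$ be a unit-speed curve on a surface $M$ in the Galilean space $G^3$, with normal curvature $\kappa_n$, which is a geodesic ($\kappa_g\equiv0$) and a generalized helix ($\tau/\kappa$ is constant, where $\kappa$ and $\tau$ are the curvature and torsion of $\beta$). Then there are real constants $d,d_1,d_2$ such that, for a suitable choice of antiderivatives (with the same antiderivative $\int\kappa_n(x)\,dx$ in both components), $$\beta(x)=\Bigg(x,\ \int\!\!\int\kappa_n(x)\Big[\cos\Big(d\int\kappa_n(x)dx\Big)+d_1\Big]dx\,dx,\ -\int\!\!\int\kappa_n(x)\Big[\sin\Big(d\int\kappa_n(x)dx\Big)+d_2\Big]dx\,dx\Bigg).$$ If $d=0$, the expression $d\int\kappa_n(x)\,dx$ is understood as an arbitrary real constant (an antiderivative of $d\,\kappa_n$), the same in both components.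
   Context: The Galilean space $G^3$ is $\mathbb R^3$ with the scalar product $\mathbf v\cdot_G\mathbf w=v_1w_1$ if $v_1\ne0$ or $w_1\neq 0$, and $\mathbf v\cdot_G\mathbf w=v_2w_2+v_3w_3$ if $v_1=w_1=0$; the norm is $\|\mathbf v\|_G=\sqrt{|\mathbf v\cdot_G\mathbf v|}$ and the cross product is $\mathbf v\times_G\mathbf w=(0,\,v_3w_1-v_1w_3,\,v_1w_2-v_2w_1)$. A vector is isotropic if its first component is $0$. All objects are smooth and $I\subset\mathbb R$ is an open interval. $M$ is an oriented surface with local parametrizations $\phi(u,v)$ such that the first components of $\phi_u,\phi_v$ are not both zero; its unit normal is the isotropic vector field $\mathbf n=\pm\,\phi_u\times_G\phi_v/\|\phi_u\times_G\phi_v\|_G$ (sign fixed by the orientation). A unit-speed curve (parametrized by arc length) is one of the form $\beta(x)=(x,y(x),z(x))$, $x\in I$. Its curvature is $\kappa=\|\beta''\|_G$, assumed positive, and its torsion is $\tau=\det(\beta',\beta'',\beta''')/\kappa^2$. Its Darboux frame with respect to $M$ is $\{\mathbf T,\mathbf Q,\mathbf n\}$ with $\mathbf T=\beta'$, $\mathbf n$ the unit normal of $M$ along $\beta$, and $\mathbf Q=\mathbf T\times_G\mathbf n$. The functions $\kappa_g=\mathbf T'\cdot_G\mathbf Q$, $\kappa_n=\mathbf T'\cdot_G\mathbf n$, $\tau_g=\mathbf Q'\cdot_G\mathbf n$ are the geodesic curvature, normal curvature and geodesic torsion. The symbol $\int g(x)\,dx$ denotes an antiderivative of $g$ on $I$.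 *)

(* Defs.v *)
From Stdlib Require Export Reals.
From Coquelicot Require Export Coquelicot.

Open Scope R_scope.

Definition vec3 : Type := (R * R * R)%type.

Definition px (v : vec3) : R := fst (fst v).
Definition py (v : vec3) : R := snd (fst v).
Definition pz (v : vec3) : R := snd v.

Definition isotropic (v : vec3) : Prop := px v = 0.

Definition dotG (v w : vec3) : R :=
  if Req_EM_T (px v) 0 then
    if Req_EM_T (px w) 0 then py v * py w + pz v * pz w
    else px v * px w
  else px v * px w.

Definition normG (v : vec3) : R := sqrt (Rabs (dotG v v)).

Definition crossG (v w : vec3) : vec3 :=
  (0, pz v * px w - px v * pz w, px v * py w - py v * px w).

Definition det3 (u v w : vec3) : R :=
    px u * (py v * pz w - pz v * py w)
  - py u * (px v * pz w - pz v * px w)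
  + pz u * (px v * py w - py v * px w).

(* The open interval ]a, b[, possibly unbounded. *)
Definition in_itv (a b : Rbar) (x : R) : Prop := Rbar_lt a x /\ Rbar_lt x b.

Definition vderive (c : R -> vec3) (x : R) : vec3 :=
  (Derive (fun t => px (c t)) x,
   Derive (fun t => py (c t)) x,
   Derive (fun t => pz (c t)) x).

Definition smooth_curve (a b : Rbar) (c : R -> vec3) : Prop :=
  forall (k : nat) (x : R), in_itv a b x ->
    ex_derive_n (fun t => px (c t)) k x /\
    ex_derive_n (fun t => py (c t)) k x /\
    ex_derive_n (fun t => pz (c t)) k x.

Definition unit_speed (a b : Rbar) (beta : R -> vec3) : Prop :=
  forall x : R, in_itv a b x -> px (beta x) = x.

Definition curvature (beta : R -> vec3) (x : R) : R :=
  normG (vderive (vderive beta) x).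

Definition torsion (beta : R -> vec3) (x : R) : R :=
  det3 (vderive beta x) (vderive (vderive beta) x)
       (vderive (vderive (vderive beta)) x)
  / (curvature beta x) ^ 2.

Definition generalized_helix (a b : Rbar) (beta : R -> vec3) : Prop :=
  exists c : R, forall x : R, in_itv a b x ->
    torsion beta x / curvature beta x = c.

Definition partial_u (phi : R * R -> vec3) (p : R * R) : vec3 :=
  vderive (fun t => phi (t, snd p)) (fst p).
Definition partial_v (phi : R * R -> vec3) (p : R * R) : vec3 :=
  vderive (fun t => phi (fst p, t)) (snd p).

Definition smooth_on (U : R * R -> Prop) (f : R * R -> R) : Prop :=
  forall (k : nat) (u v : R), U (u, v) -> ex_diff_n (fun s t => f (s, t)) k u v.

(* [phi], restricted to [U], is a smooth immersion, nowhere tangent to the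
   isotropic plane, and a homeomorphism onto an open subset of [M]: it is
   injective and open as a map into [M] with the subspace topology. *)
Record local_param (M : vec3 -> Prop) (U : R * R -> Prop)
    (phi : R * R -> vec3) : Prop := {
  lp_open : open U;
  lp_smooth : smooth_on U (fun p => px (phi p)) /\
              smooth_on U (fun p => py (phi p)) /\
              smooth_on U (fun p => pz (phi p));
  lp_regular : forall p : R * R, U p -> forall s t : R,
    plus (scal s (partial_u phi p)) (scal t (partial_v phi p)) = zero ->
    s = 0 /\ t = 0;
  lp_admissible : forall p : R * R, U p ->
    ~ (isotropic (partial_u phi p) /\ isotropic (partial_v phi p));
  lp_inj : forall p q : R * R, U p -> U q -> phi p = phi q -> p = q;
  lp_open_map : forall W : R * R -> Prop, open W -> (forall p, W p -> U p) ->
    exists V : vec3 -> Prop, open V /\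
      forall r : vec3, (exists p : R * R, W p /\ phi p = r) <-> (V r /\ M r)
}.

Definition param_normal (phi : R * R -> vec3) (p : R * R) : vec3 :=
  let w := crossG (partial_u phi p) (partial_v phi p) in scal (/ normG w) w.

(* The orientation is carried by the unit normal field: over every local
   parametrization it is [param_normal] up to a sign, and this sign is locally
   constant.  Values of [normal] off [carrier] are irrelevant. *)
Record oriented_surface : Type := {
  carrier : vec3 -> Prop;
  normal : vec3 -> vec3;
  surface_cover : forall r : vec3, carrier r ->
    exists (U : R * R -> Prop) (phi : R * R -> vec3) (p : R * R),
      local_param carrier U phi /\ U p /\ phi p = r;
  normal_spec : forall (U : R * R -> Prop) (phi : R * R -> vec3),
    local_param carrier U phi ->
    forall p : R * R, U p ->
    exists s : R, (s = 1 \/ s = -1) /\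
      locally p (fun q => U q -> normal (phi q) = scal s (param_normal phi q))
}.

Definition darboux_T (beta : R -> vec3) : R -> vec3 := vderive beta.
Definition darboux_n (M : oriented_surface) (beta : R -> vec3) (x : R) : vec3 :=
  normal M (beta x).
Definition darboux_Q (M : oriented_surface) (beta : R -> vec3) (x : R) : vec3 :=
  crossG (darboux_T beta x) (darboux_n M beta x).

Definition geodesic_curvature (M : oriented_surface) (beta : R -> vec3)
    (x : R) : R :=
  dotG (vderive (darboux_T beta) x) (darboux_Q M beta x).
Definition normal_curvature (M : oriented_surface) (beta : R -> vec3)
    (x : R) : R :=
  dotG (vderive (darboux_T beta) x) (darboux_n M beta x).

Definition is_geodesic (a b : Rbar) (M : oriented_surface)
    (beta : R -> vec3) : Prop :=
  forall x : R, in_itv a b x -> geodesic_curvature M beta x = 0.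

Definition antiderivative_on (a b : Rbar) (F f : R -> R) : Prop :=
  forall x : R, in_itv a b x -> is_derive F x (f x).

Definition double_antiderivative_on (a b : Rbar) (F f : R -> R) : Prop :=
  exists G : R -> R, antiderivative_on a b G f /\ antiderivative_on a b F G.

(* Main.v *)
(** For a geodesic the acceleration [(0, y'', z'')] equals [kappa_n * n], so
    [|kappa_n| = kappa] never vanishes.  As [n] is continuous along the curve,
    [kappa_n = e * kappa] with a constant sign [e]; in particular [n] is
    differentiable along the curve.  With [tau = c * kappa] the Frenet equations
    say that [n] rotates in the isotropic plane at speed proportional to
    [kappa_n]; hence [n = (0, cos (d K + th), - sin (d K + th))] with
    [d = - c e] and [K' = kappa_n].  The formula holds with [d1 = d2 = 0]; for
    [d <> 0] the phase [th] is absorbed into the antiderivative [K]. *)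
Require Import Defs.
From Stdlib Require Import Lra Ranalysis5.

(** * Calculus on an open, possibly unbounded interval *)

Lemma locally_in_itv (a b : Rbar) (x : R) :
  in_itv a b x -> locally x (in_itv a b).
Proof.
  intros [Hax Hxb].
  apply (locally_interval _ x a b Hax Hxb); intros y Hay Hyb; now split.
Qed.

Lemma in_itv_inhabited (a b : Rbar) :
  Rbar_lt a b -> exists x : R, in_itv a b x.
Proof.
  unfold in_itv; destruct a as [a | |], b as [b | |]; simpl; intros Hab;
    try contradiction.
  - exists ((a + b) / 2); lra.
  - exists (a + 1); lra.
  - exists (b - 1); lra.
  - exists 0; auto.
Qed.

Lemma in_itv_convex (a b : Rbar) (x y t : R) :
  in_itv a b x -> in_itv a b y -> Rmin x y <= t <= Rmax x y -> in_itv a b t.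
Proof.
  intros [Hax Hxb] [Hay Hyb] [Hlo Hhi]; split.
  - apply (Rbar_lt_le_trans _ (Rmin x y)); [|exact Hlo].
    unfold Rmin; destruct (Rle_dec x y); assumption.
  - apply (Rbar_le_lt_trans _ (Rmax x y)); [exact Hhi|].
    unfold Rmax; destruct (Rle_dec x y); assumption.
Qed.

Lemma null_derivative_in_itv (a b : Rbar) (f : R -> R) (x y : R) :
  (forall t, in_itv a b t -> is_derive f t 0) ->
  in_itv a b x -> in_itv a b y -> f x = f y.
Proof.
  intros Hf Hx Hy.
  destruct (MVT_gen f x y (fun _ => 0)) as [c [_ Hc]]; [| |lra].
  - intros t Ht; apply Hf, (in_itv_convex a b x y); auto; lra.
  - intros t Ht; apply continuity_pt_filterlim.
    apply (ex_derive_continuous f); exists 0.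
    now apply Hf, (in_itv_convex a b x y).
Qed.

Lemma nonvanishing_same_sign_lt (f : R -> R) (x y : R) :
  x < y -> (forall t, x <= t <= y -> continuous f t) ->
  (forall t, x <= t <= y -> f t <> 0) -> 0 < f x * f y.
Proof.
  intros Hxy Hc Hnz.
  assert (Hx := Hnz x ltac:(lra)); assert (Hy := Hnz y ltac:(lra)).
  destruct (Rlt_dec (f x) 0) as [Hfx|Hfx], (Rlt_dec (f y) 0) as [Hfy|Hfy];
    try nra; exfalso.
  - destruct (IVT_interv f x y) as [z [Hz Hfz]]; try lra.
    + intros t Ht; now apply continuity_pt_filterlim, Hc.
    + exact (Hnz z Hz Hfz).
  (* [IVT_interv] wants a change from negative to positive values, hence the passage to [- f]. *)
  - destruct (IVT_interv (fun t => - f t) x y) as [z [Hz Hfz]]; try lra.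
    + intros t Ht; now apply continuity_pt_opp, continuity_pt_filterlim, Hc.
    + apply (Hnz z Hz); lra.
Qed.

(** The intermediate value theorem again. The product form is symmetric in the two points, so their
    order is immaterial; it later fixes the sign of the normal curvature. *)
Lemma nonvanishing_same_sign (a b : Rbar) (f : R -> R) (x y : R) :
  (forall t, in_itv a b t -> continuous f t) ->
  (forall t, in_itv a b t -> f t <> 0) ->
  in_itv a b x -> in_itv a b y -> 0 < f x * f y.
Proof.
  intros Hc Hnz Hx Hy.
  assert (Hin : forall t, Rmin x y <= t <= Rmax x y -> in_itv a b t)
    by (intros t; now apply in_itv_convex).
  destruct (Rtotal_order x y) as [Hxy|[<-|Hxy]].
  - rewrite Rmin_left, Rmax_right in Hin by lra.
    apply nonvanishing_same_sign_lt; auto.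
  - specialize (Hnz x Hx); nra.
  - rewrite Rmin_right, Rmax_left in Hin by lra.
    rewrite Rmult_comm; apply nonvanishing_same_sign_lt; auto.
Qed.

Lemma continuous_antiderivative (a b : Rbar) (f : R -> R) :
  Rbar_lt a b -> (forall t, in_itv a b t -> continuous f t) ->
  exists F : R -> R, antiderivative_on a b F f.
Proof.
  intros Hab Hc; destruct (in_itv_inhabited a b Hab) as [x0 Hx0].
  exists (RInt f x0); intros x Hx.
  apply (is_derive_RInt f (RInt f x0) x0); [|now apply Hc].
  apply (filter_imp (in_itv a b)); [|now apply locally_in_itv].
  intros y Hy; apply (RInt_correct f), (ex_RInt_continuous f).
  intros z Hz; now apply Hc, (in_itv_convex a b x0 y).
Qed.

(** * Rotation of unit vectors in the isotropic plane *)

Lemma unit_circle_angle (A B : R) :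
  A ^ 2 + B ^ 2 = 1 -> exists th : R, A = cos th /\ B = sin th.
Proof.
  intros H; assert (HA : -1 <= A <= 1) by nra.
  assert (Hs : sqrt (1 - A²) = Rabs B).
  { rewrite <- sqrt_Rsqr_abs; f_equal; unfold Rsqr; nra. }
  (* An arccosine has nonnegative sine, so the sign of [B] decides between [acos A] and its
     negative. *)
  destruct (Rle_dec 0 B) as [HB|HB].
  - exists (acos A); rewrite cos_acos, sin_acos, Hs, Rabs_pos_eq; auto.
  - exists (- acos A).
    rewrite cos_neg, sin_neg, cos_acos, sin_acos, Hs, Rabs_left by lra.
    split; lra.
Qed.

(* Multiplying the complex number [N2 + i N3] by [exp (i d K)] gives a
   function with zero derivative. *)
Lemma rotating_unit_vector (a b : Rbar) (k K N2 N3 : R -> R) (d : R) :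
  Rbar_lt a b -> antiderivative_on a b K k ->
  (forall x, in_itv a b x -> is_derive N2 x (d * k x * N3 x)) ->
  (forall x, in_itv a b x -> is_derive N3 x (- (d * k x * N2 x))) ->
  (forall x, in_itv a b x -> N2 x ^ 2 + N3 x ^ 2 = 1) ->
  exists c : R, forall x, in_itv a b x ->
    N2 x = cos (d * K x + c) /\ N3 x = - sin (d * K x + c).
Proof.
  intros Hab HK H2 H3 Hunit.
  destruct (in_itv_inhabited a b Hab) as [x0 Hx0].
  set (A := fun x => N2 x * cos (d * K x) - N3 x * sin (d * K x)).
  set (B := fun x => N2 x * sin (d * K x) + N3 x * cos (d * K x)).
  assert (HA : forall x, in_itv a b x -> A x = A x0).
  { intros x Hx; apply (null_derivative_in_itv a b); auto; intros t Ht.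
    pose proof (HK t Ht) as hK; pose proof (H2 t Ht) as h2;
      pose proof (H3 t Ht) as h3.
    unfold A; auto_derive.
    - repeat split; eexists; eassumption.
    - rewrite (is_derive_unique (fun u : R => K u) _ _ hK),
        (is_derive_unique (fun u : R => N2 u) _ _ h2),
        (is_derive_unique (fun u : R => N3 u) _ _ h3); ring. }
  assert (HB : forall x, in_itv a b x -> B x = B x0).
  { intros x Hx; apply (null_derivative_in_itv a b); auto; intros t Ht.
    pose proof (HK t Ht) as hK; pose proof (H2 t Ht) as h2;
      pose proof (H3 t Ht) as h3.
    unfold B; auto_derive.
    - repeat split; eexists; eassumption.
    - rewrite (is_derive_unique (fun u : R => K u) _ _ hK),
        (is_derive_unique (fun u : R => N2 u) _ _ h2),
        (is_derive_unique (fun u : R => N3 u) _ _ h3); ring. }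
  assert (Hcs : forall t, cos t * cos t = 1 - sin t * sin t).
  { intros t; pose proof (sin2_cos2 t) as h; unfold Rsqr in h; lra. }
  (* The target form is [N2 + i N3 = exp (- i (d K + c))], so [A + i B] must be [exp (- i c)]; this
     explains the minus sign before [B]. *)
  destruct (unit_circle_angle (A x0) (- B x0)) as [c [HcA HcB]].
  { rewrite <- (Hunit x0 Hx0); unfold A, B; ring_simplify.
    pose proof (sin2_cos2 (d * K x0)) as h; unfold Rsqr in h; nra. }
  exists c; intros x Hx.
  specialize (HA x Hx); specialize (HB x Hx); specialize (Hcs (d * K x)).
  rewrite cos_plus, sin_plus, <- HcA, <- HcB, <- HA, <- HB; unfold A, B.
  split; ring [Hcs].
Qed.

(* In terms of the plane curve with acceleration [(p, q)], the derivative of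
   the principal normal is the torsion times the binormal. *)
Lemma is_derive_normalize (p q : R -> R) (x dp dq : R) :
  is_derive p x dp -> is_derive q x dq -> 0 < p x ^ 2 + q x ^ 2 ->
  is_derive (fun t => p t / sqrt (p t ^ 2 + q t ^ 2)) x
    (- (q x * (p x * dq - q x * dp)) / sqrt (p x ^ 2 + q x ^ 2) ^ 3).
Proof.
  intros hp hq Hpos.
  assert (Hs := sqrt_lt_R0 _ Hpos).
  assert (Hss : sqrt (p x ^ 2 + q x ^ 2) ^ 2 = p x ^ 2 + q x ^ 2)
    by (apply pow2_sqrt; lra).
  auto_derive.
  - repeat split; try (eexists; eassumption); simpl in *; lra.
  - rewrite (is_derive_unique (fun u : R => p u) _ _ hp),
      (is_derive_unique (fun u : R => q u) _ _ hq).
    simpl in *.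
    set (s := sqrt _) in *.
    (* With the square root abstracted to [s], this relation is all that is left of its definition;
       [ring] uses it to eliminate the square of [q x]. *)
    assert (Hq : q x * q x = s * s - p x * p x) by lra.
    field_simplify_eq; [|lra].
    ring [Hq].
Qed.

(** * Continuity of vector-valued maps and of partial derivatives *)

Lemma continuous_pair {S T U : UniformSpace} (f : S -> T) (g : S -> U) (x : S) :
  continuous f x -> continuous g x -> continuous (fun y => (f y, g y)) x.
Proof.
  intros Hf Hg; apply filterlim_locally; intros eps.
  apply (filter_and (fun y => ball (f x) eps (f y))
                    (fun y => ball (g x) eps (g y))).
  - now apply (proj1 (filterlim_locally f (f x)) Hf).
  - now apply (proj1 (filterlim_locally g (g x)) Hg).
Qed.

Lemma continuous_vec3 {S : UniformSpace} (f : S -> vec3) (x : S) :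
  continuous (fun y => px (f y)) x -> continuous (fun y => py (f y)) x ->
  continuous (fun y => pz (f y)) x -> continuous f x.
Proof.
  intros Hx Hy Hz.
  apply (continuous_ext (fun y => ((px (f y), py (f y)), pz (f y)))).
  - intros y; now destruct (f y) as [[? ?] ?].
  - now repeat apply continuous_pair.
Qed.

Lemma continuous_py {S : UniformSpace} (f : S -> vec3) (x : S) :
  continuous f x -> continuous (fun y => py (f y)) x.
Proof.
  intros Hf; unfold py.
  apply (continuous_comp (fun y => fst (f y)) snd); [|apply continuous_snd].
  apply (continuous_comp f fst); [exact Hf|apply continuous_fst].
Qed.

Lemma continuous_pz {S : UniformSpace} (f : S -> vec3) (x : S) :
  continuous f x -> continuous (fun y => pz (f y)) x.
Proof.
  intros Hf; apply (continuous_comp f snd); [exact Hf|apply continuous_snd].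
Qed.

(** Order 1 of [ex_diff_n] includes order 0 for both partial derivatives, and order 0 is joint
    continuity. *)
Lemma continuous_partials (f : R * R -> R) (p : R * R) :
  ex_diff_n (fun s t => f (s, t)) 1 (fst p) (snd p) ->
  continuous (fun q => Derive (fun t => f (t, snd q)) (fst q)) p /\
  continuous (fun q => Derive (fun t => f (fst q, t)) (snd q)) p.
Proof.
  destruct p as [u v]; simpl; intros (_ & _ & _ & [Hu _] & [Hv _]).
  split.
  - exact (proj1 (continuity_2d_pt_filterlim _ u v) Hu).
  - exact (proj1 (continuity_2d_pt_filterlim _ u v) Hv).
Qed.

(** * The unit normal of a surface *)

Lemma normG_isotropic (v : vec3) :
  px v = 0 -> normG v = sqrt (py v ^ 2 + pz v ^ 2).
Proof.
  intros Hv; unfold normG, dotG.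
  destruct (Req_EM_T (px v) 0) as [_|h]; [|now elim h].
  rewrite Rabs_pos_eq by nra; f_equal; ring.
Qed.

(** If [w] vanished, the combination of [phi_u] and [phi_v] with coefficients [px phi_v] and
    [- px phi_u] would be zero: its first component cancels, and the others are those of [w] up to
    sign and order. Regularity then makes both partials isotropic, against admissibility. *)
Lemma param_cross_pos (S : vec3 -> Prop) (U : R * R -> Prop)
    (phi : R * R -> vec3) (p : R * R) :
  local_param S U phi -> U p ->
  let w := crossG (partial_u phi p) (partial_v phi p) in
  0 < py w ^ 2 + pz w ^ 2.
Proof.
  intros Hphi Hp w; destruct (Rlt_dec 0 (py w ^ 2 + pz w ^ 2)) as [|Hn];
    [assumption|exfalso].
  assert (Hy : py w = 0) by nra; assert (Hz : pz w = 0) by nra.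
  apply (lp_admissible _ _ _ Hphi p Hp).
  destruct (lp_regular _ _ _ Hphi p Hp
              (px (partial_v phi p)) (- px (partial_u phi p))) as [H1 H2].
  - unfold w, crossG in Hy, Hz.
    destruct (partial_u phi p) as [[u1 u2] u3],
      (partial_v phi p) as [[v1 v2] v3].
    unfold px, py, pz in *; simpl in *.
    change ((v1 * u1 + - u1 * v1, v1 * u2 + - u1 * v2, v1 * u3 + - u1 * v3)
            = ((0, 0, 0) : vec3)).
    repeat apply f_equal2; lra.
  - unfold isotropic; lra.
Qed.

Lemma param_normal_unit (S : vec3 -> Prop) (U : R * R -> Prop)
    (phi : R * R -> vec3) (p : R * R) :
  local_param S U phi -> U p ->
  px (param_normal phi p) = 0 /\
  py (param_normal phi p) ^ 2 + pz (param_normal phi p) ^ 2 = 1.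
Proof.
  intros Hphi Hp; pose proof (param_cross_pos S U phi p Hphi Hp) as Hpos.
  cbv zeta in Hpos.
  assert (Hs := sqrt_lt_R0 _ Hpos).
  assert (Hss := pow2_sqrt _ (Rlt_le _ _ Hpos)).
  unfold param_normal; cbv zeta.
  rewrite normG_isotropic by reflexivity.
  set (w := crossG _ _) in *; set (s := sqrt _) in *.
  change (/ s * 0 = 0 /\ (/ s * py w) ^ 2 + (/ s * pz w) ^ 2 = 1).
  split; [ring|].
  rewrite !Rpow_mult_distr, <- Rmult_plus_distr_l, <- Hss.
  field; lra.
Qed.

Lemma param_normal_continuous (S : vec3 -> Prop) (U : R * R -> Prop)
    (phi : R * R -> vec3) (p : R * R) :
  local_param S U phi -> U p -> continuous (param_normal phi) p.
Proof.
  intros Hphi Hp; destruct (lp_smooth _ _ _ Hphi) as (Sx & Sy & Sz).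
  assert (Hp' : U (fst p, snd p)) by (now destruct p).
  destruct (continuous_partials (fun q => px (phi q)) p) as [Hxu Hxv];
    [now apply (Sx 1%nat)|].
  destruct (continuous_partials (fun q => py (phi q)) p) as [Hyu Hyv];
    [now apply (Sy 1%nat)|].
  destruct (continuous_partials (fun q => pz (phi q)) p) as [Hzu Hzv];
    [now apply (Sz 1%nat)|].
  set (w := fun q => crossG (partial_u phi q) (partial_v phi q)).
  assert (Hwy : continuous (fun q => py (w q)) p).
  { apply (continuous_minus (V := R_NormedModule));
      now apply (continuous_mult (K := R_AbsRing)). }
  assert (Hwz : continuous (fun q => pz (w q)) p).
  { apply (continuous_minus (V := R_NormedModule));
      now apply (continuous_mult (K := R_AbsRing)). }
  pose proof (param_cross_pos S U phi p Hphi Hp) as Hpos; fold (w p) in Hpos.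
  cbv zeta in Hpos.
  apply (continuous_scal (fun q => / normG (w q)) w).
  - apply (continuous_comp (fun q => normG (w q)) Rinv).
    (* [normG] is defined by cases; on cross products, which are isotropic, it equals a Euclidean
       norm whose continuity is clear. *)
    + apply (continuous_ext (fun q => sqrt (py (w q) ^ 2 + pz (w q) ^ 2))).
      { intros q; now rewrite normG_isotropic. }
      apply (continuous_comp (fun q => py (w q) ^ 2 + pz (w q) ^ 2) sqrt);
        [|apply continuous_sqrt].
      apply (continuous_plus (V := R_NormedModule)); simpl;
        repeat (apply (continuous_mult (K := R_AbsRing));
                try apply continuous_const; auto).
    + apply continuous_Rinv; rewrite normG_isotropic by reflexivity.
      now apply Rgt_not_eq, sqrt_lt_R0.
  - apply continuous_vec3; auto; apply continuous_const.
Qed.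

Lemma normal_unit (M : oriented_surface) (r : vec3) : carrier M r ->
  px (normal M r) = 0 /\ py (normal M r) ^ 2 + pz (normal M r) ^ 2 = 1.
Proof.
  intros Hr; destruct (surface_cover M r Hr) as (U & phi & p & Hphi & Hp & <-).
  destruct (normal_spec M U phi Hphi p Hp) as (s & Hs & Hloc).
  rewrite (locally_singleton _ _ Hloc Hp).
  destruct (param_normal_unit _ _ _ p Hphi Hp) as [Hx Hyz].
  destruct (param_normal phi p) as [[n1 n2] n3].
  unfold px, py, pz in *; simpl fst in *; simpl snd in *.
  change (s * n1 = 0 /\ (s * n2) ^ 2 + (s * n3) ^ 2 = 1).
  destruct Hs as [-> | ->]; split; nra.
Qed.

(* Since [phi] is an open map into [M], nearby points of the curve lift to
   parameters near [p], where the normal is close to its value at [p]. *)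
Lemma normal_continuous_along (M : oriented_surface) (beta : R -> vec3) (x : R) :
  carrier M (beta x) -> locally x (fun t => carrier M (beta t)) ->
  continuous beta x -> continuous (fun t => normal M (beta t)) x.
Proof.
  intros Hx HM Hc.
  destruct (surface_cover M _ Hx) as (U & phi & p & Hphi & Hp & Hpx).
  destruct (normal_spec M U phi Hphi p Hp) as (s & _ & Hloc).
  pose proof (locally_singleton _ _ Hloc Hp) as Hnp; simpl in Hnp.
  rewrite Hpx in Hnp.
  assert (HU : locally p U) by now apply (lp_open _ _ _ Hphi).
  assert (Hcs : continuous (fun q => scal s (param_normal phi q) : vec3) p).
  { apply (continuous_scal_r s (param_normal phi)).
    now apply (param_normal_continuous (carrier M) U). }
  intros P HP; rewrite Hnp in HP.
  pose proof (Hcs P HP) as HPp; unfold filtermap in HPp.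
  (* [D] is a neighbourhood of [p] because the sign [s] is the same at all parameters of [U] near
     [p]. *)
  set (D := fun q => U q /\ P (normal M (phi q))).
  assert (HD : locally p D).
  { generalize (filter_and _ _ HU (filter_and _ _ Hloc HPp)).
    apply filter_imp; intros q (HUq & Hnq & HPq); split; [assumption|].
    now rewrite (Hnq HUq). }
  (* [D] need not be open, so the open-map property is applied to its interior. *)
  destruct (lp_open_map _ _ _ Hphi (fun q => locally q D)) as (V & HV & HVM).
  { intros q; apply locally_locally. }
  { intros q Hq; apply (locally_singleton _ _ Hq). }
  assert (HVx : V (beta x)) by (apply HVM; exists p; now split).
  generalize (filter_and _ _ HM (Hc V (HV _ HVx))).
  unfold filtermap; apply filter_imp; intros t [Ht HVt].
  destruct (proj2 (HVM (beta t)) (conj HVt Ht)) as (q & Hq & <-).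
  apply (locally_singleton _ _ Hq).
Qed.

(** * Unit-speed curves and the acceleration of a geodesic *)

Lemma unit_speed_velocity (a b : Rbar) (beta : R -> vec3) (x : R) :
  unit_speed a b beta -> in_itv a b x -> px (vderive beta x) = 1.
Proof.
  intros Hb Hx; unfold vderive, px at 1; simpl.
  rewrite (Derive_ext_loc _ (fun t => t)); [apply Derive_id|].
  apply (filter_imp (in_itv a b)); [exact Hb|now apply locally_in_itv].
Qed.

Lemma unit_speed_acceleration (a b : Rbar) (beta : R -> vec3) (x : R) :
  unit_speed a b beta -> in_itv a b x -> px (vderive (vderive beta) x) = 0.
Proof.
  intros Hb Hx; unfold vderive at 1, px at 1; simpl.
  rewrite (Derive_ext_loc _ (fun _ => 1)); [apply Derive_const|].
  apply (filter_imp (in_itv a b)); [|now apply locally_in_itv].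
  intros t Ht; now apply (unit_speed_velocity a b).
Qed.

Lemma smooth_curve_continuous (a b : Rbar) (beta : R -> vec3) (x : R) :
  smooth_curve a b beta -> in_itv a b x -> continuous beta x.
Proof.
  intros Hb Hx; destruct (Hb 1%nat x Hx) as (h1 & h2 & h3).
  apply continuous_vec3.
  - exact (ex_derive_continuous _ _ h1).
  - exact (ex_derive_continuous _ _ h2).
  - exact (ex_derive_continuous _ _ h3).
Qed.

(** Since [T] has first component 1 and [n = (0, n2, n3)], the vector [Q] is [(0, - n3, n2)].
    Vanishing geodesic curvature thus makes the isotropic acceleration parallel to the unit vector
    [n], and the factor is their scalar product. *)
Lemma geodesic_acceleration (a b : Rbar) (M : oriented_surface)
    (beta : R -> vec3) (x : R) :
  (forall t, in_itv a b t -> carrier M (beta t)) -> unit_speed a b beta ->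
  is_geodesic a b M beta -> in_itv a b x ->
  py (vderive (vderive beta) x) =
    normal_curvature M beta x * py (normal M (beta x)) /\
  pz (vderive (vderive beta) x) =
    normal_curvature M beta x * pz (normal M (beta x)) /\
  normal_curvature M beta x =
    py (vderive (vderive beta) x) * py (normal M (beta x)) +
    pz (vderive (vderive beta) x) * pz (normal M (beta x)).
Proof.
  intros HM Hb Hgeo Hx.
  destruct (normal_unit M _ (HM x Hx)) as [Hn1 Hn].
  pose proof (unit_speed_velocity a b beta x Hb Hx) as HT.
  pose proof (unit_speed_acceleration a b beta x Hb Hx) as Hacc.
  specialize (Hgeo x Hx).
  unfold normal_curvature, geodesic_curvature, darboux_Q, darboux_n, darboux_T
    in *.
  destruct (vderive (vderive beta) x) as [[t1 t2] t3],
    (normal M (beta x)) as [[n1 n2] n3], (vderive beta x) as [[v1 v2] v3].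
  unfold crossG, dotG, px, py, pz in *; simpl in *; subst.
  destruct (Req_EM_T 0 0) as [_|h]; [|now elim h].
  assert (Hg : t3 * n2 = t2 * n3) by lra.
  repeat split.
  - transitivity (t2 * (n2 ^ 2 + n3 ^ 2)); [simpl; rewrite Hn; ring|ring [Hg]].
  - transitivity (t3 * (n2 ^ 2 + n3 ^ 2)); [simpl; rewrite Hn; ring|ring [Hg]].
Qed.

(** * Geodesics that are generalized helices *)

Theorem corollary4p4 (a b : Rbar) (hab : Rbar_lt a b)
    (M : oriented_surface) (beta : R -> vec3)
    (hsmooth : smooth_curve a b beta)
    (hM : forall x : R, in_itv a b x -> carrier M (beta x))
    (hunit : unit_speed a b beta)
    (hcurv : forall x : R, in_itv a b x -> 0 < curvature beta x)
    (hgeo : is_geodesic a b M beta)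
    (hhelix : generalized_helix a b beta) :
  exists (d d1 d2 : R) (K Theta Y Z : R -> R),
    antiderivative_on a b K (normal_curvature M beta) /\
    (* Theta is the phase d * K, or an arbitrary constant when d = 0 *)
    (d <> 0 -> forall x : R, in_itv a b x -> Theta x = d * K x) /\
    (d = 0 -> exists c : R, forall x : R, in_itv a b x -> Theta x = c) /\
    double_antiderivative_on a b Y
      (fun x => normal_curvature M beta x * (cos (Theta x) + d1)) /\
    double_antiderivative_on a b Z
      (fun x => normal_curvature M beta x * (sin (Theta x) + d2)) /\
    (forall x : R, in_itv a b x -> beta x = (x, Y x, - Z x)).
Proof.
  set (kn := normal_curvature M beta).
  set (y := fun t => py (beta t)); set (z := fun t => pz (beta t)).
  set (p := Derive (Derive y)); set (q := Derive (Derive z)).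
  set (n2 := fun x => py (normal M (beta x))).
  set (n3 := fun x => pz (normal M (beta x))).
  assert (Hacc : forall x, in_itv a b x ->
    p x = kn x * n2 x /\ q x = kn x * n3 x /\ kn x = p x * n2 x + q x * n3 x).
  { intros x Hx; exact (geodesic_acceleration a b M beta x hM hunit hgeo Hx). }
  assert (Hn : forall x, in_itv a b x -> n2 x ^ 2 + n3 x ^ 2 = 1).
  { intros x Hx; exact (proj2 (normal_unit M _ (hM x Hx))). }
  assert (Hpq : forall x, in_itv a b x -> p x ^ 2 + q x ^ 2 = kn x ^ 2).
  { intros x Hx; destruct (Hacc x Hx) as (-> & -> & _).
    rewrite !Rpow_mult_distr, <- Rmult_plus_distr_l, Hn by assumption; ring. }
  assert (Hkappa : forall x, in_itv a b x ->
    curvature beta x = sqrt (p x ^ 2 + q x ^ 2)).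
  { intros x Hx; unfold curvature; rewrite normG_isotropic; [reflexivity|].
    now apply (unit_speed_acceleration a b). }
  assert (Hpos : forall x, in_itv a b x -> 0 < p x ^ 2 + q x ^ 2).
  { intros x Hx; specialize (hcurv x Hx); rewrite Hkappa in hcurv by assumption.
    destruct (Rlt_dec 0 (p x ^ 2 + q x ^ 2)) as [|h]; [assumption|].
    rewrite sqrt_neg_0 in hcurv by lra; lra. }
  (* [ex_derive_n] at order 3 means that the second derivative is differentiable. *)
  assert (Hdp : forall x, in_itv a b x -> is_derive p x (Derive p x)).
  { intros x Hx; apply Derive_correct.
    exact (proj1 (proj2 (hsmooth 3%nat x Hx))). }
  assert (Hdq : forall x, in_itv a b x -> is_derive q x (Derive q x)).
  { intros x Hx; apply Derive_correct.
    exact (proj2 (proj2 (hsmooth 3%nat x Hx))). }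
  (* The relation [kn = p n2 + q n3] reduces this to continuity of the normal along the curve;
     differentiability of the normal is not yet known. *)
  assert (Hkc : forall x, in_itv a b x -> continuous kn x).
  { intros x Hx.
    assert (Hnc : continuous (fun t => normal M (beta t)) x).
    { apply normal_continuous_along; [now apply hM| |].
      - apply (filter_imp (in_itv a b)); [exact hM|now apply locally_in_itv].
      - now apply (smooth_curve_continuous a b). }
    apply (continuous_ext_loc kn (fun t => p t * n2 t + q t * n3 t)).
    - apply (filter_imp (in_itv a b)); [|now apply locally_in_itv].
      intros t Ht; symmetry; apply (Hacc t Ht).
    - apply (continuous_plus (V := R_NormedModule));
        apply (continuous_mult (K := R_AbsRing)).
      + apply (ex_derive_continuous p); eexists; now apply Hdp.
      + now apply continuous_py.
      + apply (ex_derive_continuous q); eexists; now apply Hdq.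
      + now apply continuous_pz. }
  assert (Hkn0 : forall x, in_itv a b x -> kn x <> 0).
  { intros x Hx h; pose proof (Hpos x Hx) as h'.
    rewrite Hpq, h in h' by assumption; lra. }
  assert (Hsign : exists e : R, e * e = 1 /\ forall x, in_itv a b x ->
    sqrt (p x ^ 2 + q x ^ 2) = e * kn x).
  { destruct (in_itv_inhabited a b hab) as [x0 Hx0].
    pose proof (Hkn0 x0 Hx0) as H0.
    assert (Hs : forall x, in_itv a b x -> 0 < kn x0 * kn x)
      by (intros x Hx; now apply (nonvanishing_same_sign a b)).
    destruct (Rlt_dec 0 (kn x0)) as [Hlt|Hge];
      [exists 1|exists (- 1)]; (split; [ring|]); intros x Hx;
      specialize (Hs x Hx); rewrite Hpq, <- Rsqr_pow2, sqrt_Rsqr_abs by assumption.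
    - rewrite Rabs_pos_eq; nra.
    - rewrite Rabs_left; nra. }
  destruct Hsign as (e & He & Hsq).
  destruct hhelix as [c Hc].
  (* Acceleration and its derivative are isotropic and the velocity has first component 1, so the
     determinant in the torsion is [p q' - q p']. It equals [tau * kappa ^ 2], that is
     [c * kappa ^ 3], with [kappa = e * kn]. *)
  assert (Htau : forall x, in_itv a b x ->
    p x * Derive q x - q x * Derive p x = c * (e * kn x) ^ 3).
  { intros x Hx; rewrite <- Hsq, <- Hkappa, <- (Hc x Hx) by assumption.
    unfold torsion, det3.
    rewrite (unit_speed_velocity a b), (unit_speed_acceleration a b)
      by assumption.
    assert (Hthird : px (vderive (vderive (vderive beta)) x) = 0).
    { unfold vderive at 1, px at 1; simpl.
      rewrite (Derive_ext_loc _ (fun _ => 0)); [apply Derive_const|].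
      apply (filter_imp (in_itv a b)); [|now apply locally_in_itv].
      intros t Ht; now apply (unit_speed_acceleration a b). }
    rewrite Hthird.
    change (py (vderive (vderive beta) x)) with (p x).
    change (pz (vderive (vderive beta) x)) with (q x).
    change (py (vderive (vderive (vderive beta)) x)) with (Derive p x).
    change (pz (vderive (vderive (vderive beta)) x)) with (Derive q x).
    specialize (hcurv x Hx); field; lra. }
  assert (He0 : e <> 0) by nra.
  (* Up to the constant sign [e], the surface normal is the principal normal of the curve; this
     makes it differentiable. *)
  assert (Hn2 : forall t, in_itv a b t ->
    n2 t = e * (p t / sqrt (p t ^ 2 + q t ^ 2))).
  { intros t Ht; rewrite Hsq by assumption.
    destruct (Hacc t Ht) as (-> & _ & _); field; auto. }
  (* The squares are swapped so that [is_derive_normalize] applies with [p] and [q] exchanged. *)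
  assert (Hn3 : forall t, in_itv a b t ->
    n3 t = e * (q t / sqrt (q t ^ 2 + p t ^ 2))).
  { intros t Ht; rewrite (Rplus_comm (q t ^ 2)), Hsq by assumption.
    destruct (Hacc t Ht) as (_ & -> & _); field; auto. }
  destruct (continuous_antiderivative a b kn hab Hkc) as [K HK].
  (* Differentiating [n2 = e * p / kappa] gives [- e * c * q], and [q = kn * n3]; this is
     [d * kn * n3] for the present [d]. *)
  set (d := - (c * e)).
  destruct (rotating_unit_vector a b kn K n2 n3 d hab HK) as [th Hth].
  { intros x Hx.
    apply (is_derive_ext_loc (fun t => e * (p t / sqrt (p t ^ 2 + q t ^ 2)))).
    - apply (filter_imp (in_itv a b)); [|now apply locally_in_itv].
      intros t Ht; symmetry; now apply Hn2.
    - pose proof (is_derive_normalize p q x _ _ (Hdp x Hx) (Hdq x Hx) (Hpos x Hx))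
        as h.
      rewrite Htau, Hsq in h by assumption.
      apply (is_derive_scal _ _ e) in h.
      replace (d * kn x * n3 x) with
        (e * (- (q x * (c * (e * kn x) ^ 3)) / (e * kn x) ^ 3)); [exact h|].
      destruct (Hacc x Hx) as (_ & -> & _); unfold d; field; auto. }
  { intros x Hx.
    apply (is_derive_ext_loc (fun t => e * (q t / sqrt (q t ^ 2 + p t ^ 2)))).
    - apply (filter_imp (in_itv a b)); [|now apply locally_in_itv].
      intros t Ht; symmetry; now apply Hn3.
    - pose proof (is_derive_normalize q p x _ _ (Hdq x Hx) (Hdp x Hx)) as h.
      rewrite (Rplus_comm (q x ^ 2)), Hsq in h by assumption.
      specialize (h (Hpos x Hx)).
      replace (q x * Derive p x - p x * Derive q x)
        with (- (c * (e * kn x) ^ 3)) in h by (rewrite <- Htau by assumption; ring).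
      apply (is_derive_scal _ _ e) in h.
      replace (- (d * kn x * n2 x)) with
        (e * (- (p x * - (c * (e * kn x) ^ 3)) / (e * kn x) ^ 3)); [exact h|].
      destruct (Hacc x Hx) as (-> & _ & _); unfold d; field; auto. }
  { exact Hn. }
  (* For [d <> 0] the shift [th / d] turns [d * K + th] into [d] times the new antiderivative. For
     [d = 0] the quotient is some real constant, harmless in an antiderivative, and the phase is the
     constant [th]. *)
  exists d, 0, 0, (fun x => K x + th / d), (fun x => d * K x + th), y,
    (fun x => - z x).
  split; [|split; [|split; [|split; [|split]]]].
  - intros x Hx; rewrite <- (Rplus_0_r (kn x)).
    apply (is_derive_plus K (fun _ => th / d)); [now apply HK|].
    apply (is_derive_const (V := R_NormedModule)).
  - intros Hd x Hx; field; exact Hd.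
  - intros Hd; exists th; intros x Hx; rewrite Hd; ring.
  - exists (Derive y); split; intros x Hx.
    + fold kn; rewrite Rplus_0_r, <- (proj1 (Hth x Hx)).
      rewrite <- (proj1 (Hacc x Hx)); apply Derive_correct.
      exact (proj1 (proj2 (hsmooth 2%nat x Hx))).
    + apply Derive_correct; exact (proj1 (proj2 (hsmooth 1%nat x Hx))).
  - exists (fun x => - Derive z x); split; intros x Hx.
    + fold kn; rewrite Rplus_0_r.
      (* Here [q = kn * n3] and [n3] is minus the sine: hence [Z = - z] and the minus sign in the
         third component of the curve. *)
      replace (kn x * sin (d * K x + th)) with (- q x).
      2: { destruct (Hacc x Hx) as (_ & -> & _).
           rewrite (proj2 (Hth x Hx)); ring. }
      apply (is_derive_opp (Derive z)), Derive_correct.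
      exact (proj2 (proj2 (hsmooth 2%nat x Hx))).
    + apply (is_derive_opp z), Derive_correct.
      exact (proj2 (proj2 (hsmooth 1%nat x Hx))).
  - intros x Hx; rewrite Ropp_involutive; unfold y, z.
    rewrite <- (hunit x Hx) at 2.
    now destruct (beta x) as [[? ?] ?].
Qed.
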